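(* Let $L:\mathbb{R}^n\to\mathbb{R}$ be a convex function, and for $\varepsilon>0$ and $x\in\mathbb{R}^n$ let $$T_\varepsilon(x)=\frac{1}{|B(x,\varepsilon)|}\int_{B(x,\varepsilon)}\nabla L(z)\,dz .$$ Suppose that, for every $x\in\mathbb{R}^n$, the limit $$\lim_{\varepsilon\to 0}T_\varepsilon(x)=y(x)$$ exists. Then $y:\mathbb{R}^n\to\mathbb{R}^n$ is a Borel measurable map such that $y(x)\in\partial L(x)$ for every $x\in\mathbb{R}^n$.
   Context: $B(x,\varepsilon)$ is the Euclidean ball in $\mathbb{R}^n$ with center $x$ and radius $\varepsilon$, and $|B(x,\varepsilon)|$ is its Lebesgue measure. A convex function $L:\mathbb{R}^n\to\mathbb{R}$ is differentiable on a Borel set $E$ of full Lebesgue measure, and the integral defining $T_\varepsilon(x)$ is understood as the integral over $B(x,\varepsilon)\cap E$. The subdifferential of $L$ at $x$ is $$\partial L(x)=\{y\in\mathbb{R}^n: L(z)\ge L(x)+\langle y,z-x\rangle \text{ for all } z\in\mathbb{R}^n\}.$$ *)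

(* Defs.v *)
From HB Require Import structures.
From mathcomp Require Import all_boot all_order all_algebra.
From mathcomp Require Import all_classical all_reals all_analysis measurable_realfun.

Set Implicit Arguments.
Unset Strict Implicit.
Unset Printing Implicit Defensive.

Import Order.TTheory GRing.Theory Num.Theory.
Import numFieldNormedType.Exports.

Local Open Scope classical_set_scope.
Local Open Scope ring_scope.

(* R^n is 'rV[R]_n.  The library gives it the sup norm; its topology, hence its
   Borel sets, limits and Frechet differentiability, are the Euclidean ones. *)

HB.instance Definition _ (R : realType) (n : nat) :=
  @isMeasurable.Build (sigma_display (@open 'rV[R]_n)) 'rV[R]_n
    <<s @open 'rV[R]_n >> (@sigma_algebra0 _ setT (@open 'rV[R]_n))
    (@sigma_algebraC _ (@open 'rV[R]_n))
    (@sigma_algebra_bigcup _ setT (@open 'rV[R]_n)).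

Section borel_rV.
Context {R : realType}.

Lemma open_measurable_rV n (U : set 'rV[R]_n) : open U -> measurable U.
Proof. exact: sub_sigma_algebra. Qed.

Lemma measurable_coord n (i : 'I_n) :
  measurable_fun [set: 'rV[R]_n] (fun v => v ord0 i : R).
Proof.
apply: (measurability _ (RGenOpens.measurableE R)) => _ [_ [a [b ->] <-]].
rewrite setTI; apply: open_measurable_rV; apply: open_comp.
  by move=> v _; exact: coord_continuous.
exact: interval_open.
Qed.

Let box n (a : 'rV[rat]_n * nat) : set 'rV[R]_n :=
  [set v | forall i, ball (ratr (a.1 ord0 i) : R) a.2.+1%:R^-1 (v ord0 i : R)].

Let open_box n (U : set 'rV[R]_n) : open U ->
  U = \bigcup_(a in [set: 'rV[rat]_n * nat])
        (if `[< box a `<=` U >] then box a else set0).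
Proof.
move=> oU; apply/seteqP; split => [v Uv|v [a _]]; last first.
  by case: asboolP => // /[apply].
have /nbhs_ballP[e /= e0 eU] : nbhs v U by apply: open_nbhs_nbhs; split.
have e20 : 0 < e / 2 by rewrite divr_gt0.
have /(_ (e / 2) e20)[k _ /(_ k (leqnn _)) ke] :
    forall d : R, 0 < d -> \forall k \near \oo, k.+1%:R^-1 < d :> R.
  move=> d d0; near=> k.
  by near: k; exact: (near_infty_natSinv_lt (PosNum d0)).
have k0 : 0 < k.+1%:R^-1 :> R by rewrite invr_gt0.
have ratv (i : 'I_n) : exists q : rat, `|(ratr q : R) - v ord0 i| < k.+1%:R^-1.
  have /rat_in_itvoo[q] :
    (v ord0 i - k.+1%:R^-1 : R) < v ord0 i + k.+1%:R^-1.
    by rewrite ltrBlDr -addrA ltrDl addr_gt0.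
  by rewrite in_itv/= => qv; exists q; rewrite ltr_distl.
have [q qv] := choice ratv.
exists (\row_i q i, k) => //; case: asboolP => [_ i|[]].
  by rewrite /= mxE; exact: qv.
move=> w bw; apply: eU; split=> // i j.
rewrite ord1 /ball /=; have := bw j; rewrite /ball/= mxE => qw.
rewrite -(subrKA (ratr (q j) : R)) (le_lt_trans (ler_normD _ _))//.
rewrite (splitr e) ltrD// ?(lt_trans qw)// distrC (lt_trans (qv j))//.
Unshelve. all: by end_near. Qed.

Lemma measurable_fun_rVP d (T : measurableType d) n (f : T -> 'rV[R]_n) :
  (forall i, measurable_fun [set: T] (fun t => f t ord0 i : R)) ->
  measurable_fun [set: T] f.
Proof.
move=> mf; apply: (measurability (@open 'rV[R]_n)) => // _ [U oU <-].
rewrite setTI (open_box oU) preimage_bigcup.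
apply: countable_bigcupT_measurable => [|a]; first exact: countableP.
case: asboolP => _; last by rewrite preimage_set0; exact: measurable0.
rewrite [X in measurable X](_ : _ = \bigcap_(i in [set: 'I_n])
   ((fun t => f t ord0 i) @^-1` ball (ratr (a.1 ord0 i) : R) a.2.+1%:R^-1)).
  apply: fin_bigcap_measurable => // i _; rewrite -[X in measurable X]setTI.
  apply: mf => //; apply: open_measurable; exact: ball_open.
by apply/seteqP; split => t /= => [bt i _|bt i]; [exact: bt|exact: bt i I].
Qed.

End borel_rV.

(* R^(n+1) = R x R^n. *)
Definition rV_cons {R : realType} {n : nat} (p : R * 'rV[R]_n) : 'rV[R]_n.+1 :=
  row_mx p.1%:M p.2.

(* Lebesgue measure on the Borel sets of R^n, as an n-fold product measure;
   lebesgue_rV_box below gives its value on boxes. *)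
Fixpoint lebesgue_rV (R : realType) (n : nat) : set 'rV[R]_n -> \bar R :=
  match n with
  | 0 => \d_(0 : 'rV[R]_0)
  | m.+1 => pushforward
      (product_measure1 (@lebesgue_measure R) (@lebesgue_rV R m)) rV_cons
  end.
Arguments lebesgue_rV {R} n.

Section lebesgue_rV_theory.
Context {R : realType}.
Local Open Scope ereal_scope.

Lemma rV_cons0 n (p : R * 'rV[R]_n) : rV_cons p ord0 ord0 = p.1.
Proof.
transitivity (row_mx p.1%:M p.2 ord0 (lshift n ord0)).
  by congr (row_mx _ _ _ _); exact: val_inj.
by rewrite row_mxEl mxE eqxx mulr1n.
Qed.

Lemma rV_consS n (p : R * 'rV[R]_n) (i : 'I_n) :
  rV_cons p ord0 (lift ord0 i) = p.2 ord0 i.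
Proof.
transitivity (row_mx p.1%:M p.2 ord0 (rshift 1 i)).
  by congr (row_mx _ _ _ _); exact: val_inj.
by rewrite row_mxEr.
Qed.

Lemma measurable_rV_cons n : measurable_fun [set: R * 'rV[R]_n] rV_cons.
Proof.
apply: measurable_fun_rVP => i; have [j ->|->] := unliftP ord0 i.
- rewrite (_ : (fun _ => _) = (fun v : 'rV[R]_n => v ord0 j : R) \o snd).
    by apply: measurableT_comp => //; exact: measurable_coord.
  by apply/funext => p /=; rewrite rV_consS.
- rewrite (_ : (fun _ => _) = fst) //.
  by apply/funext => p /=; rewrite rV_cons0.
Qed.

Let rV_uncons n (v : 'rV[R]_n.+1) : R * 'rV[R]_n :=
  (v ord0 ord0, \row_i v ord0 (lift ord0 i)).

Let rV_consK n : cancel (@rV_cons R n) (@rV_uncons n).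
Proof.
move=> [x v]; congr pair; first by rewrite rV_cons0.
by apply/rowP => i; rewrite mxE rV_consS.
Qed.

Let measurable_rV_uncons n : measurable_fun [set: 'rV[R]_n.+1] (@rV_uncons n).
Proof.
apply: measurable_fun_pair; first exact: measurable_coord.
apply: measurable_fun_rVP => i.
under eq_fun do rewrite mxE.
exact: measurable_coord.
Qed.

Let sigma_finite_product d1 d2 (T1 : measurableType d1) (T2 : measurableType d2)
    (m1 : {sigma_finite_measure set T1 -> \bar R})
    (m2 : {sigma_finite_measure set T2 -> \bar R}) :
  sigma_finite setT (product_measure1 m1 m2).
Proof.
have /sigma_finiteP[F [TF ndF Foo]] := sigma_finiteT m1.
have /sigma_finiteP[G [TG ndG Goo]] := sigma_finiteT m2.
exists (fun k => F k `*` G k) => [|k].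
  rewrite -setXTT TF TG; apply/seteqP; split => [[x y]|[x y] [k _ []]].
    move=> [/= [i _ Fx] [j _ Gy]]; exists (maxn i j) => //; split.
    - by move: x Fx; exact/subsetPset/ndF/leq_maxl.
    - by move: y Gy; exact/subsetPset/ndG/leq_maxr.
  by split; exists k.
have [? ?] := Foo k; have [? ?] := Goo k; split; first exact: measurableX.
by rewrite product_measure1E// lte_mul_pinfty// ge0_fin_numE.
Qed.

Let lebesgue_rV_ex n : {mu : {sigma_finite_measure set 'rV[R]_n -> \bar R} |
  lebesgue_rV n = mu :> (set 'rV[R]_n -> \bar R)}.
Proof.
elim: n => [|n [mu lemu]].
  by exists \d_(0%R : 'rV[R]_0).
pose p : {measure set (measurableTypeR R * 'rV[R]_n)%type -> \bar R} :=
  product_measure1 (@lebesgue_measure R) mu.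
have sf : sigma_finite setT (pushforward p (@rV_cons R n)).
  have [F FT mF] := sigma_finite_product (@lebesgue_measure R) mu.
  exists (fun k => @rV_uncons n @^-1` F k) => [|k].
    by rewrite -preimage_bigcup -FT preimage_setT.
  have [mFk Fk] := mF k; split.
    by rewrite -[X in measurable X]setTI; exact: measurable_rV_uncons.
  rewrite /pushforward -comp_preimage (_ : _ \o _ = id) //.
  by apply/funext => q; exact: rV_consK.
pose m : {measure set 'rV[R]_n.+1 -> \bar R} :=
  measure_function_pushforward__canonical__measure_function_Measure
    p (@measurable_rV_cons n).
pose H := Measure_isSigmaFinite.Build _ _ _ m sf.
pose nu : {sigma_finite_measure set 'rV[R]_n.+1 -> \bar R} :=
  HB.pack (Measure.sort m) H.
by exists nu; rewrite /= lemu.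
Qed.

Let lebesgue_rV0 n : @lebesgue_rV R n set0 = 0.
Proof. by have [mu ->] := lebesgue_rV_ex n; exact: measure0. Qed.

Let lebesgue_rV_ge0 n A : 0 <= @lebesgue_rV R n A.
Proof. by have [mu ->] := lebesgue_rV_ex n; exact: measure_ge0. Qed.

Let lebesgue_rV_sigma_additive n : semi_sigma_additive (@lebesgue_rV R n).
Proof.
by have [mu ->] := lebesgue_rV_ex n; exact: measure_semi_sigma_additive.
Qed.

HB.instance Definition _ n := isMeasure.Build _ _ _ (@lebesgue_rV R n)
  (lebesgue_rV0 n) (@lebesgue_rV_ge0 n) (@lebesgue_rV_sigma_additive n).

Let lebesgue_rV_sigma_finite n : sigma_finite setT (@lebesgue_rV R n).
Proof. by have [mu ->] := lebesgue_rV_ex n; exact: sigma_finiteT. Qed.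

HB.instance Definition _ n := Measure_isSigmaFinite.Build _ _ _
  (@lebesgue_rV R n) (lebesgue_rV_sigma_finite n).

Lemma lebesgue_rV_box n (A : 'I_n -> set R) : (forall i, measurable (A i)) ->
  lebesgue_rV n [set v : 'rV[R]_n | forall i, A i (v ord0 i)] =
  \prod_(i < n) lebesgue_measure (A i).
Proof.
elim: n A => [|n IHn] A mA.
  by rewrite big_ord0 /= diracE mem_set// => i; have := ltn_ord i.
rewrite big_ord_recl/= -IHn//= /pushforward.
have mB : measurable [set v : 'rV[R]_n | forall i, A (lift ord0 i) (v ord0 i)].
  rewrite [X in measurable X](_ : _ = \bigcap_(i in [set: 'I_n])
      ((fun v : 'rV[R]_n => v ord0 i) @^-1` A (lift ord0 i))).
    apply: fin_bigcap_measurable => // i _; rewrite -[X in measurable X]setTI.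
    exact: measurable_coord.
  by apply/seteqP; split => v /= => [Av i _|Av i]; [exact: Av|exact: Av i I].
rewrite -product_measure1E//; last exact: mA.
congr (_ _).
apply/seteqP; split => [[x v] /= Axv|[x v] /= [Ax Av] i].
  split => [|i]; first by have := Axv ord0; rewrite rV_cons0.
  by have := Axv (lift ord0 i); rewrite rV_consS.
by have [j ->|->] := unliftP ord0 i; rewrite ?rV_consS ?rV_cons0.
Qed.

End lebesgue_rV_theory.

Definition dotprod {R : realType} {n : nat} (u v : 'rV[R]_n) : R :=
  \sum_(i < n) u ord0 i * v ord0 i.

Definition euclid_norm {R : realType} {n : nat} (u : 'rV[R]_n) : R :=
  Num.sqrt (dotprod u u).

Definition euclid_ball {R : realType} {n : nat} (x : 'rV[R]_n) (e : R) :
    set 'rV[R]_n :=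
  [set z | euclid_norm (z - x) < e].

(* Only meaningful at the points where L is differentiable. *)
Definition gradient {R : realType} {n : nat} (L : 'rV[R]_n -> R)
    (z : 'rV[R]_n) : 'rV[R]_n :=
  \row_(i < n) 'D_(delta_mx ord0 i) L z.

Definition differentiability_set {R : realType} {n : nat}
    (L : 'rV[R]_n -> R) : set 'rV[R]_n :=
  [set z | differentiable L z].

(* A convex function is differentiable almost everywhere: the gradient is
   integrated, coordinatewise, over the part of the ball where it exists.  Any
   other Borel set of differentiability points of full measure gives the same
   value. *)
Definition ball_average_gradient {R : realType} {n : nat}
    (L : 'rV[R]_n -> R) (e : R) (x : 'rV[R]_n) : 'rV[R]_n :=
  (fine (lebesgue_rV n (euclid_ball x e)))^-1 *:
  \row_(i < n)
    \int[lebesgue_rV n]_(z in euclid_ball x e `&` differentiability_set L)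
      gradient L z ord0 i.

Definition subdifferential {R : realType} {n : nat} (L : 'rV[R]_n -> R)
    (x : 'rV[R]_n) : set 'rV[R]_n :=
  [set y | forall z, L z >= L x + dotprod y (z - x)].

(* Main.v *)
Require Import Defs.
From HB Require Import structures.
From mathcomp Require Import all_boot all_order all_algebra.
From mathcomp Require Import all_classical all_reals all_analysis measurable_realfun.
From mathcomp Require Import ring lra.
Import Order.TTheory GRing.Theory Num.Theory.
Import numFieldNormedType.Exports.
Local Open Scope classical_set_scope.
Local Open Scope ring_scope.

Set Implicit Arguments.
Unset Strict Implicit.

(* A convex L is continuous, and where all its partial derivatives exist it is
   differentiable.  A point where L is not differentiable is therefore a kink
   along some coordinate axis, with rationals p < q separating the left from the
   right derivative.  For fixed (p, q) and axis the kinks form a closed set that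
   meets each parallel of the axis at most once, hence a null set by Fubini: L
   is differentiable almost everywhere, on a Borel set.  There
   <grad L(z), u> <= L(z + u) - L(z); averaging over z in B(x, e) and using the
   continuity of L, the limit y(x) satisfies <y(x), u> <= L(x + u) - L(x) for
   all u.  By Fubini-Tonelli each T_e is Borel, hence so is the limit of
   T_{1/k} as k tends to infinity. *)

(** * Chord slopes of a convex function along a line *)

Section convex_lmod.
Context {R : realType} {E : lmodType R}.
Variable f : E -> R.
Hypothesis f_convex : convex_function [set: E] f.

Lemma convex_functionP (t : R) (t01 : 0 <= t <= 1) (x y : E) :
  f (t *: x + (1 - t) *: y) <= t * f x + (1 - t) * f y.
Proof.
exact: (f_convex (Itv01 (andP t01).1 (andP t01).2) (in_setT x) (in_setT y)).
Qed.

(** By induction: the mean of m + 2 points gives weight 1/(m + 2) to the first one and the remaining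
    weight to the mean of the others. *)
Lemma convex_mean m (v : 'I_m.+1 -> E) :
  f (m.+1%:R^-1 *: \sum_i v i) <= m.+1%:R^-1 * \sum_i f (v i).
Proof.
elim: m v => [|m IHm] v.
  by rewrite !big_ord_recl !big_ord0 !addr0 invr1 scale1r mul1r.
rewrite !(big_ord_recl m.+1) /=; set s := \sum_i _; set S := \sum_i _.
have m0 : m.+2%:R != 0 :> R by rewrite pnatr_eq0.
have m1 : m.+1%:R != 0 :> R by rewrite pnatr_eq0.
have m2 : 0 <= (m.+2%:R^-1 : R) <= 1.
  by rewrite invr_ge0 ler0n/= invf_le1// ler1n.
have e : 1 - m.+2%:R^-1 = m.+2%:R^-1 * m.+1%:R :> R.
  apply: (mulfI m0); rewrite mulrA mulrBr mulr1 !mulfV//.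
  by rewrite mul1r -(natr1 m.+1) addrK.
have := convex_functionP m2 (v ord0) (m.+1%:R^-1 *: s).
rewrite scalerA e mulfK// -scalerDr => /le_trans; apply.
rewrite mulrDr lerD2l -mulrA ler_wpM2l ?(andP m2).1//.
by rewrite -ler_pdivlMl ?ltr0n// IHm.
Qed.

(** Difference quotients increase because [x + s *: v] is the convex combination of [x + t *: v] and
    [x] with weight s/t. Cleared of denominators, the inequality covers s = 0 and t = 0 as well. *)
Lemma convex_slope (x v : E) (s t : R) (st : 0 <= s <= t) :
  t * (f (x + s *: v) - f x) <= s * (f (x + t *: v) - f x).
Proof.
case/andP: st => s0 st; have [t0|t0] := eqVneq t 0.
  have s00 : s = 0 by apply/eqP; rewrite eq_le s0 andbT -t0.
  by rewrite t0 s00 !mul0r.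
have tp : 0 < t by rewrite lt_def t0 (le_trans s0).
have st1 : 0 <= s / t <= 1 by rewrite divr_ge0 ?(ltW tp)//= ler_pdivrMr// mul1r.
have := convex_functionP st1 (x + t *: v) x.
rewrite scalerDr scalerA divfK// addrAC -scalerDl addrC subrKC scale1r addrC.
move=> h; have {}h : f (x + s *: v) - f x <= s / t * (f (x + t *: v) - f x).
  by rewrite lerBlDr (le_trans h)//; lra.
by rewrite -ler_pdivlMl// mulrA [_ * s]mulrC.
Qed.

Lemma convex_reflect (x v : E) : f x - f (x - v) <= f (x + v) - f x.
Proof.
have h : 0 <= (2^-1 : R) <= 1 by lra.
have := convex_functionP h (x + v) (x - v).
have -> : 1 - 2^-1 = 2^-1 :> R by lra.
rewrite -scalerDr addrACA subrr addr0.
rewrite -[x + x]mulr2n -[x *+ 2]scaler_nat scalerA.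
rewrite mulVf ?pnatr_eq0// scale1r => ?; lra.
Qed.

(** Left difference quotients stay below right ones: monotonicity shrinks the larger of the two
    steps to the smaller, and [convex_reflect] compares equal steps. *)
Lemma convex_slopeN (x v : E) (s t : R) : 0 < s -> 0 < t ->
  t * (f x - f (x - s *: v)) <= s * (f (x + t *: v) - f x).
Proof.
move=> s0 t0; have [st|/ltW ts] := leP s t.
  apply: (le_trans _ (convex_slope _ _ (_ : 0 <= s <= t))); last first.
    by rewrite (ltW s0).
  by rewrite ler_wpM2l ?(ltW t0)// convex_reflect.
have := @convex_slope x (- v) t s; rewrite (ltW t0) ts => /(_ isT).
rewrite !scalerN => h; have := convex_reflect x (t *: v).
by rewrite -(ler_pM2l s0) => h2; lra.
Qed.

End convex_lmod.

(* For convex [f]: along [v], the left derivative of [f] at [z] is at most [p]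
   and the right one is at least [q]. *)
Definition kink {R : realType} {E : lmodType R} (f : E -> R) (v : E)
    (p q : R) : set E :=
  [set z | forall h : R, 0 < h ->
    q * h <= f (z + h *: v) - f z /\ f z - f (z - h *: v) <= p * h].

(** * Kinks and one-sided derivatives *)

Section kink_theory.
Context {R : realType} {E : lmodType R}.
Variable f : E -> R.

(** For s < t, the slope of the chord between the two kinks would be at least q, seen from its left
    end, and at most p, seen from its right end. *)
Lemma kink_line_eq (v z : E) (p q s t : R) : p < q ->
  kink f v p q (z + s *: v) -> kink f v p q (z + t *: v) -> s = t.
Proof.
move=> pq; wlog st : s t / s < t.
  move=> wl ks kt; have [st|ts|//] := ltgtP s t; first exact: wl.
  by apply/esym/wl.
have ts0 : 0 < t - s by rewrite subr_gt0.
have e1 : z + s *: v + (t - s) *: v = z + t *: v.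
  by rewrite -addrA -scalerDl subrKC.
have e2 : z + t *: v - (t - s) *: v = z + s *: v by rewrite -e1 addrK.
move=> /(_ _ ts0)[h1 _] /(_ _ ts0)[_ h2]; move: h1 h2; rewrite e1 e2.
by move=> /le_trans/[apply]; rewrite ler_pM2r// leNgt pq.
Qed.

Hypothesis f_convex : convex_function [set: E] f.

(** The derivative d is the infimum of the right quotients [Q]; in the absence of kinks it is at
    most the supremum of the left quotients [P]. Upper bounds on increments are enough here, since
    [convex_axes_bound] recovers the lower ones by reflection. *)
Lemma convex_no_kink_derivative (v z : E) :
  (forall p q : rat, p < q -> ~ kink f v (ratr p) (ratr q) z) ->
  exists d : R, forall e, 0 < e -> exists2 r, 0 < r & forall s, `|s| <= r ->
    f (z + s *: v) - f z - s * d <= e * `|s|.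
Proof.
move=> nokink.
pose Q h := h^-1 * (f (z + h *: v) - f z).
pose P h := h^-1 * (f z - f (z - h *: v)).
pose SQ := [set Q h | h in [set h | 0 < h]].
pose SP := [set P h | h in [set h | 0 < h]].
have PQ h k : 0 < h -> 0 < k -> P h <= Q k.
  move=> h0 k0; rewrite /P /Q ler_pdivrMl// mulrCA ler_pdivlMl//.
  exact: convex_slopeN.
have SQinf : has_inf SQ.
  by split; [exists (Q 1), 1 => //=|exists (P 1) => _ [h h0 <-]; exact: PQ].
have SPsup : has_sup SP.
  by split; [exists (P 1), 1 => //=|exists (Q 1) => _ [h h0 <-]; exact: PQ].
have bQ h : 0 < h -> inf SQ <= Q h.
  by move=> h0; apply: ge_inf; [exact: SQinf.2|exists h].
have Pa h : 0 < h -> P h <= sup SP.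
  by move=> h0; apply: ub_le_sup; [exact: SPsup.2|exists h].
(* Otherwise two rationals p < q fit strictly between [sup SP] and [inf SQ] and make z a kink. *)
have ba : inf SQ <= sup SP.
  rewrite leNgt; apply/negP => /rat_in_itvoo[p].
  rewrite in_itv/= => /andP[ap pb].
  have /rat_in_itvoo[q] := pb; rewrite in_itv/= => /andP[pq qb].
  apply: (nokink p q); first by rewrite -(ltr_rat R).
  move=> h h0; split; rewrite mulrC.
    by rewrite -ler_pdivlMl// (le_trans (ltW qb))// bQ.
  by rewrite -ler_pdivrMl// (le_trans (Pa _ h0))// ltW.
exists (inf SQ) => e e0.
have [_ [h /= h0 <-] hQ] := inf_adherent e0 SQinf.
have [_ [k /= k0 <-] kP] := sup_adherent e0 SPsup.
exists (Num.min h k); first by rewrite lt_min h0.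
move=> s; rewrite le_min; have [s0|s0] := leP 0 s.
  rewrite ger0_norm// => /andP[sh _].
  have := @convex_slope _ _ _ f_convex z v s h; rewrite s0 sh => /(_ isT) sl.
  have : f (z + s *: v) - f z <= s * Q h by rewrite mulrCA ler_pdivlMl.
  move=> /le_trans le1.
  have : s * Q h <= s * (inf SQ + e) by rewrite ler_wpM2l// ltW.
  by move=> /le1 ?; lra.
(* For s < 0 the slopes are compared along -v; multiplying [P k > sup SP - e >= inf SQ - e] by s
   then reverses the order. *)
rewrite ltr0_norm// => /andP[_ sk].
have := @convex_slope _ _ _ f_convex z (- v) (- s) k.
rewrite oppr_ge0 (ltW s0) sk => /(_ isT); rewrite scaleNr scalerN opprK => sl.
have : f (z + s *: v) - f z <= s * P k.
  rewrite mulrCA ler_pdivlMl// (le_trans sl)//.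
  by rewrite scalerN le_eqVlt; apply/orP; left; apply/eqP; ring.
move=> /le_trans le1.
have : s * P k <= s * (inf SQ - e).
  by rewrite ler_wnM2l ?ltW// (le_lt_trans _ kP)// lerD2r.
by move=> /le1 ?; lra.
Qed.

End kink_theory.

(** * Linearity and continuity of the scalar product *)

Section dotprod_theory.
Context {R : realType} {n : nat}.
Implicit Types u v w : 'rV[R]_n.

Lemma dotprodC u v : dotprod u v = dotprod v u.
Proof. by apply: eq_bigr => i _; rewrite mulrC. Qed.

Lemma dotprod_is_scalar u : scalar (dotprod u).
Proof.
move=> a v w; rewrite /dotprod mulr_sumr -big_split/=.
by apply: eq_bigr => i _; rewrite !mxE mulrDr mulrCA.
Qed.

HB.instance Definition _ u :=
  GRing.isLinear.Build R 'rV[R]_n R *%R (dotprod u) (dotprod_is_scalar u).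

Lemma dotprod_delta u i : dotprod u (delta_mx ord0 i) = u ord0 i.
Proof.
rewrite /dotprod (bigD1 i)//= mxE !eqxx mulr1 big1 ?addr0// => j ji.
by rewrite mxE (negbTE ji) andbF mulr0.
Qed.

Lemma continuous_dotprod u : continuous (dotprod u).
Proof.
apply: continuous_big => [x|i _ v]; first exact: add_continuous.
apply: cvgMl_tmp; first exact: nbhs_filter.
exact: coord_continuous.
Qed.

End dotprod_theory.

Lemma near_norm_le {R : realType} {V : normedModType R} (x : V) (d : R) :
  0 < d -> \forall z \near x, `|z - x| <= d.
Proof.
by move=> d0; apply/nbhs_normP; exists d => //= z xz; rewrite distrC ltW.
Qed.

Lemma ler_norm_coord {R : realType} {n : nat} (u : 'rV[R]_n) i :
  `|u ord0 i| <= `|u|.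
Proof.
rewrite [leRHS]/Num.norm /= mx_normrE.
by apply/bigmax_geP; right => /=; exists (ord0, i).
Qed.

(** * Continuity of convex functions on R^n *)

Section convex_rV.
Context {R : realType} {n : nat}.
Variable f : 'rV[R]_n -> R.
Hypothesis f_convex : convex_function [set: 'rV[R]_n] f.
Local Notation e_ i := (delta_mx ord0 i : 'rV[R]_n).

(* [x + h] is the mean of the [n] points [x + n h_i e_i]. *)
Lemma convex_coord_split (x h : 'rV[R]_n) :
  f (x + h) - f x <=
  n%:R^-1 * \sum_i (f (x + (n%:R * h ord0 i) *: e_ i) - f x).
Proof.
case: n f f_convex x h => [|m] g g_convex x h.
  by rewrite (thinmx0 h) addr0 subrr big_ord0 mulr0.
have m0 : m.+1%:R != 0 :> R by rewrite pnatr_eq0.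
rewrite sumrB sumr_const card_ord -[g x *+ m.+1]mulr_natl mulrBr mulKf// lerD2r.
apply: le_trans (convex_mean g_convex _).
rewrite le_eqVlt; apply/orP; left; apply/eqP; congr g.
rewrite big_split/= sumr_const card_ord -[x *+ m.+1]scaler_nat.
rewrite scalerDr scalerA mulVf// scale1r; congr (_ + _).
rewrite [LHS]row_sum_delta scaler_sumr.
by apply: eq_bigr => i _; rewrite scalerA mulKf.
Qed.

(** [convex_coord_split] carries upper bounds on the axes over to every increment h, with axis steps
    as long as n|h|; [convex_reflect] then gives the lower bound. A fixed K yields continuity, an
    arbitrarily small K differentiability. *)
Lemma convex_axes_bound (x : 'rV[R]_n) (r K : R) : 0 <= K ->
  (forall i s, `|s| <= r -> f (x + s *: e_ i) - f x <= K * `|s|) ->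
  forall h, n%:R * `|h| <= r -> `|f (x + h) - f x| <= n%:R * K * `|h|.
Proof.
move=> K0 axes.
have upper h : n%:R * `|h| <= r -> f (x + h) - f x <= n%:R * K * `|h|.
  move=> hr; apply: le_trans (convex_coord_split x h) _.
  have [n0|n0] := posnP n.
    by rewrite [n in n%:R^-1]n0 invr0 mul0r !mulr_ge0.
  rewrite ler_pdivrMl ?ltr0n//.
  have le1 i : true -> f (x + (n%:R * h ord0 i) *: e_ i) - f x
      <= n%:R * K * `|h|.
    have nh : `|n%:R * h ord0 i| <= n%:R * `|h|.
      by rewrite normrM ger0_norm// ler_wpM2l// ler_norm_coord.
    move=> _; apply: le_trans (axes i _ (le_trans nh hr)) _.
    by rewrite [_ * K]mulrC -mulrA ler_wpM2l.
  apply: le_trans (ler_sum _ le1) _.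
  by rewrite sumr_const card_ord -[leLHS]mulr_natl.
move=> h hr; rewrite ler_norml upper// andbT.
have := convex_reflect f_convex x (- h); rewrite opprK => le1.
have := upper (- h); rewrite normrN => /(_ hr) le2.
by rewrite lerNl opprB (le_trans le1).
Qed.

Lemma convex_continuous : continuous f.
Proof.
move=> x; apply/(@cvgrPdist_le _ _ _ (nbhs x)) => e e0.
(* C dominates the unit-step increments in all directions e_i and -e_i; [convex_slope] scales this
   down to steps |s| <= 1. *)
pose C := \sum_i (`|f (x + e_ i) - f x| + `|f (x - e_ i) - f x|).
have C0 : 0 <= C by apply: sumr_ge0 => i _; rewrite addr_ge0.
have axes i s : `|s| <= 1 -> f (x + s *: e_ i) - f x <= C * `|s|.
  move=> s1; have Ci : `|f (x + e_ i) - f x| + `|f (x - e_ i) - f x| <= C.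
    by rewrite /C (bigD1 i)//= lerDl sumr_ge0// => j _; rewrite addr_ge0.
  rewrite mulrC; have [s0|s0] := leP 0 s.
    move: s1; rewrite ger0_norm// => s1.
    have := @convex_slope _ _ _ f_convex x (e_ i) s 1.
    rewrite s0 s1 => /(_ isT).
    rewrite mul1r scale1r => /le_trans; apply; rewrite ler_wpM2l//.
    by rewrite (le_trans _ Ci)// (le_trans (ler_norm _))// lerDl.
  move: s1; rewrite ltr0_norm// => s1.
  have := @convex_slope _ _ _ f_convex x (- e_ i) (- s) 1.
  rewrite oppr_ge0 (ltW s0) s1 => /(_ isT).
  rewrite mul1r scale1r scaleNr scalerN opprK => /le_trans; apply.
  rewrite ler_wpM2l// ?oppr_ge0 ?(ltW s0)//.
  by rewrite (le_trans _ Ci)// (le_trans (ler_norm _))// lerDr.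
(* Using n + 1 and C + 1 keeps both radii positive even when n = 0 or C = 0. *)
have n0 : 0 < n.+1%:R^-1 :> R by rewrite invr_gt0.
have nC0 : 0 < (n.+1%:R * (C + 1))^-1 * e.
  by rewrite mulr_gt0// invr_gt0 mulr_gt0// ltr_wpDl.
apply: filterS2 (near_norm_le x n0) (near_norm_le x nC0) => z.
rewrite -[n.+1%:R^-1]mulr1 ler_pdivlMl// => h1.
rewrite ler_pdivlMl; last by rewrite mulr_gt0// ltr_wpDl.
move=> h2; rewrite distrC -[z in leLHS](subrKC x).
rewrite (le_trans (convex_axes_bound C0 axes _))//.
  by rewrite (le_trans _ h1)// ler_wpM2r// ler_nat.
rewrite (le_trans _ h2)// ler_wpM2r// ler_pM//; first by rewrite ler_nat.
by rewrite lerDl.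
Qed.

End convex_rV.

(** * Differentiability away from kinks, and the gradient as a subgradient *)

Section convex_differentiability.
Context {R : realType} {n : nat}.
Variable f : 'rV[R]_n -> R.
Hypothesis f_convex : convex_function [set: 'rV[R]_n] f.
Local Notation e_ i := (delta_mx ord0 i : 'rV[R]_n).

(** Rational slopes make this a countable union, so that null pieces have a null union. *)
Definition kinks : set 'rV[R]_n :=
  \bigcup_(a in [set a : 'I_n * (rat * rat) | a.2.1 < a.2.2])
    kink f (e_ a.1) (ratr a.2.1) (ratr a.2.2).

Lemma convex_subr_dotprod (g : 'rV[R]_n) :
  convex_function [set: 'rV[R]_n] (fun w => f w - dotprod g w).
Proof.
move=> t x y _ _.
have s01 : 0 <= (t%:num : R) <= 1 by rewrite ge0 le1.
set s : R := t%:num in s01 *.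
have := convex_functionP f_convex s01 x y.
change (f (s *: x + (1 - s) *: y) <= s * f x + (1 - s) * f y ->
  f (s *: x + (1 - s) *: y) - dotprod g (s *: x + (1 - s) *: y) <=
  s * (f x - dotprod g x) + (1 - s) * (f y - dotprod g y)).
by rewrite linearD !linearZ/= => ?; lra.
Qed.

(** Subtracting the linear map built from the partial derivatives leaves a convex function [F] whose
    increments along the axes are at most K|s| for small s; [convex_axes_bound] makes all its
    increments o(h). *)
Lemma differentiable_of_not_kinks (z : 'rV[R]_n) :
  ~ kinks z -> differentiable f z.
Proof.
move=> nokink.
have partial i : exists d : R, forall e, 0 < e -> exists2 r, 0 < r &
    forall s, `|s| <= r -> f (z + s *: e_ i) - f z - s * d <= e * `|s|.
  apply: convex_no_kink_derivative => // p q pq kz.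
  by apply: nokink; exists (i, (p, q)).
have [d dP] := choice partial.
pose g : 'rV[R]_n := \row_i d i.
pose F w := f w - dotprod g w.
have FE h : F (z + h) - F z = f (z + h) - f z - dotprod g h.
  by rewrite /F linearD/=; ring.
pose G : {linear 'rV[R]_n -> R^o} := dotprod g.
have dz : (f : _ -> R^o) \o shift z = cst (f z) + G +o_ (0 : 'rV[R]_n) id.
  apply/eqaddoP => e e0.
  (* The division absorbs the factor n of [convex_axes_bound]. *)
  pose K := e / n.+1%:R.
  have K0 : 0 < K by rewrite divr_gt0.
  pose P i (h : 'rV[R]_n) := forall s, `|s| <= n%:R * `|h| ->
    f (z + s *: e_ i) - f z - s * d i <= K * `|s|.
  have : \forall h \near (0 : 'rV[R]_n), forall i, P i h.
    refine (@filter_forall _ _ P _ (nbhs_filter _) _) => i.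
    have [r r0 rz] := dP i K K0.
    have rn : 0 < n.+1%:R^-1 * r by rewrite mulr_gt0 ?invr_gt0.
    apply: filterS (near_norm_le 0 rn) => h.
    rewrite subr0 ler_pdivlMl// => hr s sh; apply: rz.
    by rewrite (le_trans sh)// (le_trans _ hr)// ler_wpM2r// ler_nat.
  apply: filterS => h hr /=.
  have -> : ((f \o shift z) - (cst (f z) + dotprod g)) h = F (z + h) - F z.
    by rewrite FE [z + h]addrC opprD addrA.
  apply: le_trans (@convex_axes_bound _ _ _ (convex_subr_dotprod g) z
    (n%:R * `|h|) K (ltW K0) _ h (lexx _)) _.
    move=> i s sh; rewrite -/(F _) -/(F _) FE linearZ/= dotprod_delta mxE.
    exact: hr.
  rewrite ler_wpM2r// /K mulrCA ler_piMr ?(ltW e0)//.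
  by rewrite ler_pdivrMr// mul1r ler_nat.
(* Differentiability is stated for the canonical differential, which uniqueness identifies with
   [dotprod g]. *)
have := diff_unique (@continuous_dotprod _ _ g) dz.
move=> dE; apply/diff_locallyP; rewrite dE; split => //.
exact: continuous_dotprod.
Qed.

Lemma differentiable_quotient_cvg (z v : 'rV[R]_n) : differentiable f z ->
  h^-1 * (f (z + h *: v) - f z) @[h --> 0^'+] --> 'D_v f z.
Proof.
move=> dz; apply: cvg_dnbhs_at_right; have := diff_derivable (v := v) dz.
rewrite (_ : (fun h => _) =
  (fun h => h^-1 *: ((f \o shift z) (h *: v) - f z)))//.
by apply/funext => h /=; rewrite [_ + z]addrC.
Qed.

(** At a kink the derivative along e_i is at least q and the one along -e_i at least -p; linearity
    of the differential would give q <= p. The equivalence makes the differentiability set Borel. *)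
Lemma differentiable_kinksP (z : 'rV[R]_n) : differentiable f z <-> ~ kinks z.
Proof.
split; last exact: differentiable_of_not_kinks.
move=> dz [[i [p q]]] /= pq kz.
have qD : ratr q <= 'D_(e_ i) f z.
  apply: cvgr_to_ge (differentiable_quotient_cvg (v := (e_ i)) dz) _.
  near=> h; have h0 : 0 < h by near: h; exact: nbhs_right_gt.
  by rewrite ler_pdivlMl// mulrC; exact: (kz h h0).1.
have Dp : - ratr p <= 'D_(- e_ i) f z.
  apply: cvgr_to_ge (differentiable_quotient_cvg (v := (- e_ i)) dz) _.
  near=> h; have h0 : 0 < h by near: h; exact: nbhs_right_gt.
  rewrite ler_pdivlMl// scalerN mulrC mulNr lerNl opprB.
  exact: (kz h h0).2.
have DN : 'D_(- e_ i) f z = - 'D_(e_ i) f z by rewrite !deriveE// linearN.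
have : ratr q <= ratr p :> R by rewrite (le_trans qD)// -lerN2 -DN.
by rewrite ler_rat leNgt pq.
Unshelve. all: by end_near. Qed.

Lemma derive_gradientE (z u : 'rV[R]_n) : differentiable f z ->
  'D_u f z = dotprod (gradient f z) u.
Proof.
move=> dz; rewrite deriveE// [in LHS](row_sum_delta u) linear_sum.
apply: eq_bigr => i _; rewrite linearZ/= mxE deriveE// mulrC//.
Qed.

(** The derivative along u is the limit of quotients which, for steps h <= 1, are at most the
    quotient at h = 1. *)
Lemma gradient_subgradient (z u : 'rV[R]_n) : differentiable f z ->
  dotprod (gradient f z) u <= f (z + u) - f z.
Proof.
move=> dz; rewrite -derive_gradientE//.
apply: cvgr_to_le (differentiable_quotient_cvg (v := u) dz) _.
near=> h; have h0 : 0 < h by near: h; exact: nbhs_right_gt.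
have h1 : h <= 1 by near: h; exact: nbhs_right_le.
have h01 : 0 <= h <= 1 by rewrite ltW.
rewrite ler_pdivrMl//.
by have := convex_slope f_convex z u h01; rewrite mul1r scale1r.
Unshelve. all: by end_near. Qed.

End convex_differentiability.

(** * Null sets recognized on parallels to an axis *)

Section lebesgue_rV_lines.
Context {R : realType}.

Lemma rV_consD_delta0 n (x t : R) (v : 'rV[R]_n) :
  rV_cons (x, v) + t *: delta_mx ord0 ord0 = rV_cons (x + t, v).
Proof.
apply/rowP => k; have [j ->|->] := unliftP ord0 k.
  by rewrite mxE !rV_consS 2!mxE/= mulr0 addr0.
by rewrite mxE !rV_cons0 2!mxE !eqxx mulr1.
Qed.

Lemma rV_consD_deltaS n (x t : R) (v : 'rV[R]_n) (j : 'I_n) :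
  rV_cons (x, v) + t *: delta_mx ord0 (lift ord0 j) =
  rV_cons (x, v + t *: delta_mx ord0 j).
Proof.
apply/rowP => k; have [l ->|->] := unliftP ord0 k.
  by rewrite mxE !rV_consS !mxE (inj_eq lift_inj).
by rewrite mxE !rV_cons0 2!mxE mulr0 addr0.
Qed.

Lemma lebesgue_rV_lines_eq0 n (i : 'I_n) (A : set 'rV[R]_n) : measurable A ->
  (forall z, lebesgue_measure
     [set t : R | A (z + t *: delta_mx ord0 i)] = 0%E) ->
  lebesgue_rV n A = 0%E.
Proof.
elim: n i A => [[]//|n IHn] i A mA A0.
have mB : measurable ((@rV_cons R n) @^-1` A).
  by rewrite -[X in measurable X]setTI; exact: measurable_rV_cons.
rewrite /= /pushforward.
(* If the axis is not the first one, it lies inside the slices with fixed first coordinate, where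
   the induction hypothesis applies. *)
have [j ij|i0] := unliftP ord0 i.
  rewrite /product_measure1 integral0_eq// => x _ /=.
  apply: (IHn j); first exact: measurable_xsection.
  move=> v; rewrite -[RHS](A0 (rV_cons (x, v))); congr lebesgue_measure.
  by apply/funext => t; rewrite /xsection/= inE ij rV_consD_deltaS.
(* For the first axis the order of integration is swapped: by uniqueness the product measure equals
   [product_measure2], whose inner measure is taken along that axis. *)
have E12 B C : measurable B -> measurable C ->
    (@lebesgue_measure R \x^ @lebesgue_rV R n)%E (B `*` C) =
    (lebesgue_measure B * lebesgue_rV n C)%E.
  by move=> mC mD; rewrite product_measure2E.
rewrite (product_measure_unique E12)//=.
rewrite /product_measure2 integral0_eq// => v _ /=.
rewrite -[RHS](A0 (rV_cons (0, v))); congr lebesgue_measure.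
by apply/funext => t; rewrite /ysection/= inE i0 rV_consD_delta0 add0r.
Qed.

End lebesgue_rV_lines.

Lemma measurable_null_countable_bigcup d (T : measurableType d)
    (R : realType) (mu : {measure set T -> \bar R}) (I : countType)
    (D : set I) (F : I -> set T) :
  (forall i, D i -> measurable (F i) /\ mu (F i) = 0%E) ->
  measurable (\bigcup_(i in D) F i) /\ mu (\bigcup_(i in D) F i) = 0%E.
Proof.
move=> FP.
(* Reindexing by codes in [nat], with the empty set at codes of no element of D, allows the use of
   [negligible_bigcup]. *)
pose G (k : nat) : set T :=
  if unpickle k is Some i then if `[< D i >] then F i else set0 else set0.
have GP k : measurable (G k) /\ mu (G k) = 0%E.
  rewrite /G; case: unpickle => [i|]; last by split => //; exact: measure0.
  case: asboolP => [/FP//|_]; split => //; exact: measure0.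
have -> : \bigcup_(i in D) F i = \bigcup_k G k.
  apply/seteqP; split => [x [i Di Fx]|x [k _]].
    by exists (pickle i) => //; rewrite /G pickleK asboolT.
  rewrite /G; case: unpickle => // i; case: asboolP => // Di Fx; by exists i.
have mG : measurable (\bigcup_k G k).
  by apply: bigcupT_measurable => k; exact: (GP k).1.
split => //; apply/negligibleP => //; apply: negligible_bigcup => k.
by apply/negligibleP; [exact: (GP k).1|exact: (GP k).2].
Qed.

(** * Borel measurability from topology *)

Section continuous_rV.
Context {R : realType} {n : nat}.

Lemma continuous_measurable_rV (g : 'rV[R]_n -> R) :
  continuous g -> measurable_fun [set: 'rV[R]_n] g.
Proof.
move=> cg; apply: (measurability _ (RGenOpens.measurableE R)).
move=> _ [_ [a [b ->] <-]]; rewrite setTI.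
apply: open_measurable_rV; apply: open_comp; last exact: interval_open.
by move=> v _; exact: cg.
Qed.

Lemma closed_measurable_rV (A : set 'rV[R]_n) : closed A -> measurable A.
Proof.
by rewrite -openC => /open_measurable_rV /measurableC; rewrite setCK.
Qed.

End continuous_rV.

(** * Almost everywhere differentiability and measurability of the gradient *)

Section kinks_null.
Context {R : realType} {n : nat}.
Variable f : 'rV[R]_n -> R.
Hypothesis f_convex : convex_function [set: 'rV[R]_n] f.

Lemma convex_continuous_addr (v : 'rV[R]_n) :
  continuous (fun z : 'rV[R]_n => f (z + v)).
Proof.
move=> z; apply: (@continuous_comp _ _ _ (fun z : 'rV[R]_n => z + v) f).
  by apply: continuousD; [exact: cvg_id|exact: cst_continuous].
exact: convex_continuous.
Qed.

Lemma closed_kink (v : 'rV[R]_n) (p q : R) : closed (kink f v p q).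
Proof.
rewrite (_ : kink f v p q = \bigcap_(h in [set h | 0 < h])
  ((fun z => f (z + h *: v) - f z) @^-1` [set t | q * h <= t] `&`
   (fun z => f z - f (z - h *: v)) @^-1` [set t | t <= p * h])); last first.
  by apply/seteqP; split.
apply: closed_bigI => h _; apply: closedI.
  apply: preimage_closed; last exact: closed_ge.
  move=> z _.
  apply: continuousB; [exact: convex_continuous_addr|exact: convex_continuous].
apply: preimage_closed; last exact: closed_le.
move=> z _.
apply: continuousB; [exact: convex_continuous|exact: convex_continuous_addr].
Qed.

(** Each piece is closed and, by [kink_line_eq], meets every parallel to its axis in at most one
    point. *)
Lemma kinks_null : measurable (kinks f) /\ lebesgue_rV n (kinks f) = 0%E.
Proof.
apply: measurable_null_countable_bigcup => -[i [p q]] /= pq.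
have mk : measurable (kink f (delta_mx ord0 i) (ratr p) (ratr q)).
  by apply: closed_measurable_rV; exact: closed_kink.
have pqR : ratr p < ratr q :> R by rewrite ltr_rat.
split => //; apply: (lebesgue_rV_lines_eq0 (i := i)) => // z.
apply: countable_lebesgue_measure0.
set S := mkset _; have [->|/set0P[s Ss]] := eqVneq S set0.
  exact: countable0.
apply: (@sub_countable _ _ _ [set s]); last exact: countable1.
apply: subset_card_le => t St /=.
exact: kink_line_eq pqR St Ss.
Qed.

Lemma differentiability_setE : differentiability_set f = ~` kinks f.
Proof.
by apply/funext => z; apply/propext; exact: differentiable_kinksP.
Qed.

Lemma measurable_differentiability_set : measurable (differentiability_set f).
Proof.
rewrite differentiability_setE; apply: measurableC; exact: kinks_null.1.
Qed.

Lemma lebesgue_rV_setI_differentiability (B : set 'rV[R]_n) : measurable B ->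
  lebesgue_rV n (B `&` differentiability_set f) = lebesgue_rV n B.
Proof.
move=> mB; have [mk k0] := kinks_null.
rewrite differentiability_setE -setDE.
have Bk0 : lebesgue_rV n (B `&` kinks f) = 0%E.
  by apply: (subset_measure0 _ mk) => //; exact: measurableI.
by rewrite [RHS](measureDI _ mB mk) -[LHS]adde0; congr (_ + _)%E.
Qed.

(** Where f is differentiable, the partial derivative is the limit of the continuous difference
    quotients with step 1/(k + 1). *)
Lemma measurable_gradient (i : 'I_n) :
  measurable_fun (differentiability_set f) (fun z => gradient f z ord0 i).
Proof.
pose e : 'rV[R]_n := delta_mx ord0 i.
pose h (k : nat) z := k.+1%:R * (f (z + k.+1%:R^-1 *: e) - f z).
apply: (measurable_fun_cvg (h := h)) => [k|z dz].
  apply: measurable_funTS; apply: measurable_funM; first exact: measurable_cst.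
  apply: continuous_measurable_rV => z.
  apply: continuousB; last exact: convex_continuous.
  exact: convex_continuous_addr.
rewrite mxE; have := differentiable_quotient_cvg (v := e) dz.
move=> /cvg_at_rightP/(_ (fun k => k.+1%:R^-1)) /=.
rewrite /h; under [in X in _ -> X]eq_fun do rewrite -[X in X * _]invrK.
by apply; split; [move=> k; rewrite invr_gt0|exact: cvg_harmonic].
Qed.

End kinks_null.

(** * Euclidean balls: comparison with cubes, measurability and measure *)

Section euclid_ball_theory.
Context {R : realType} {n : nat}.

Lemma euclid_norm_coord (u : 'rV[R]_n) i : `|u ord0 i| <= euclid_norm u.
Proof.
rewrite -sqrtr_sqr ler_wsqrtr// /dotprod (bigD1 i)//= -expr2 lerDl.
by apply: sumr_ge0 => j _; rewrite -expr2 sqr_ge0.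
Qed.

Lemma normr_le_euclid (u : 'rV[R]_n) : `|u| <= euclid_norm u.
Proof.
rewrite [leLHS]/Num.norm /= mx_normrE; apply/bigmax_leP => /=.
split; first exact: sqrtr_ge0.
by move=> [i j] _ /=; rewrite ord1; exact: euclid_norm_coord.
Qed.

(** With d = e/(n + 1), the sum of squares is at most n d^2, which is below (n + 1)^2 d^2 = e^2,
    strictly even for n = 0. *)
Lemma euclid_norm_lt (u : 'rV[R]_n) (e : R) : 0 < e ->
  (forall i, `|u ord0 i| < e / n.+1%:R) -> euclid_norm u < e.
Proof.
move=> e0 ue; set d := e / n.+1%:R.
have d0 : 0 <= d by rewrite divr_ge0 ?(ltW e0).
rewrite -[e in ltRHS]gtr0_norm// -sqrtr_sqr ltr_sqrt ?exprn_gt0//.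
have : dotprod u u <= n%:R * d ^+ 2.
  rewrite -{2}(card_ord n) mulr_natl -sumr_const; apply: ler_sum => i _.
  by rewrite -expr2 -real_normK ?num_real// lerXn2r ?nnegrE// ltW ?ue.
move=> /le_lt_trans; apply.
have -> : e = n.+1%:R * d by rewrite mulrC divfK.
rewrite [ltRHS]exprMn ltr_pM2r ?exprn_gt0 ?divr_gt0//.
by rewrite -natrX ltr_nat -{1}(expn1 n.+1) leq_pexp2l.
Qed.

Lemma measurable_euclid_dist :
  measurable_fun [set: 'rV[R]_n * 'rV[R]_n] (fun p => euclid_norm (p.2 - p.1)).
Proof.
apply: (measurableT_comp (f := @Num.sqrt R)).
  by apply: continuous_measurable_fun; exact: sqrt_continuous.
apply: measurable_sum => i; under eq_fun do rewrite !mxE.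
by apply: measurable_funM; apply: measurable_funB;
  apply: (measurableT_comp (measurable_coord i));
  first [exact: measurable_snd|exact: measurable_fst].
Qed.

(** One Borel set of the product has all balls of radius e as its sections, so that measurability in
    the center follows from Fubini-Tonelli. *)
Definition euclid_band (e : R) : set ('rV[R]_n * 'rV[R]_n) :=
  [set p | euclid_norm (p.2 - p.1) < e].

Lemma measurable_euclid_band (e : R) : measurable (euclid_band e).
Proof.
have := measurable_euclid_dist measurableT (measurable_itv `]-oo, e[).
rewrite setTI (_ : _ @^-1` _ = euclid_band e)//.
Qed.

Lemma xsection_euclid_band (e : R) (x : 'rV[R]_n) :
  xsection (euclid_band e) x = euclid_ball x e.
Proof. by apply/seteqP; split => z; rewrite /xsection /= inE. Qed.

Lemma measurable_euclid_ball (x : 'rV[R]_n) (e : R) :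
  measurable (euclid_ball x e).
Proof.
rewrite -xsection_euclid_band; apply: measurable_xsection.
exact: measurable_euclid_band.
Qed.

Lemma lebesgue_rV_cube (x : 'rV[R]_n) (d : R) : 0 < d ->
  let C := [set z : 'rV[R]_n | forall i, ball (x ord0 i) d (z ord0 i)] in
  measurable C /\ lebesgue_rV n C = ((d *+ 2) ^+ n)%:E.
Proof.
move=> d0 C; split; last first.
  have mb i : measurable (ball (x ord0 i : R) d) by exact: measurable_ball.
  rewrite (lebesgue_rV_box mb).
  under eq_bigr do rewrite lebesgue_measure_ball ?ltW//.
  by rewrite prodEFin prodr_const card_ord.
rewrite [X in measurable X](_ : _ = \bigcap_(i in [set: 'I_n])
   ((fun z : 'rV[R]_n => z ord0 i) @^-1` ball (x ord0 i) d)).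
  apply: fin_bigcap_measurable => // i _; rewrite -[X in measurable X]setTI.
  by apply: measurable_coord => //; exact: measurable_ball.
by apply/seteqP; split => v /= => [Av i _|Av i]; [exact: Av|exact: Av i I].
Qed.

(** The ball lies between the cubes of half-sides e/(n + 1) and e, so that dividing by its measure
    makes sense. *)
Lemma lebesgue_euclid_ball (x : 'rV[R]_n) (e : R) : 0 < e ->
  exists2 m, 0 < m & lebesgue_rV n (euclid_ball x e) = m%:E.
Proof.
move=> e0; have d0 : 0 < e / n.+1%:R by rewrite divr_gt0.
have [mC1 C1] := lebesgue_rV_cube x d0.
have [mC2 C2] := lebesgue_rV_cube x e0.
have mB := measurable_euclid_ball x e.
have lo : (((e / n.+1%:R *+ 2) ^+ n)%:E <= lebesgue_rV n (euclid_ball x e))%E.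
  rewrite -C1; apply: le_measure; rewrite ?inE// => z Cz.
  apply: euclid_norm_lt => // i.
  by rewrite !mxE distrC; exact: Cz.
have up : (lebesgue_rV n (euclid_ball x e) <= ((e *+ 2) ^+ n)%:E)%E.
  rewrite -C2; apply: le_measure; rewrite ?inE// => z Bz i.
  have := euclid_norm_coord (z - x) i; rewrite !mxE distrC => /le_lt_trans.
  by apply.
have c0 : 0 < (e / n.+1%:R *+ 2) ^+ n by rewrite exprn_gt0// mulrn_wgt0.
move: lo up; case: (lebesgue_rV n _) => [m| |]; rewrite ?lee_fin//.
by move=> lo _; exists m => //; exact: lt_le_trans lo.
Qed.

End euclid_ball_theory.

(** * Real-valued integrals: finite sums and dependence on a parameter *)

Lemma Rintegral_sum d (T : measurableType d) (R : realType)
    (mu : {measure set T -> \bar R}) (D : set T) (I : Type) (s : seq I)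
    (h : I -> T -> R) : measurable D ->
  (forall i, mu.-integrable D (EFin \o h i)) ->
  \int[mu]_(x in D) (\sum_(i <- s) h i x) =
  \sum_(i <- s) \int[mu]_(x in D) h i x.
Proof.
move=> mD ih; elim: s => [|i s IHs].
  under eq_Rintegral do rewrite big_nil.
  by rewrite Rintegral_cst// mul0r big_nil.
under eq_Rintegral do rewrite big_cons.
rewrite RintegralD// ?IHs ?big_cons//.
rewrite (_ : _ \o _ = fun x => (\sum_(i <- s) (h i x)%:E)%E); last first.
  by apply/funext => x /=; rewrite sumEFin.
by apply: integrable_sum => // j _; exact: ih.
Qed.

(** Tonelli handles the positive and negative parts separately. Their difference is measurable as an
    extended real function, and [fine] sends its infinite values to 0. *)
Lemma measurable_Rintegral_param d1 d2 (T1 : measurableType d1)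
    (T2 : measurableType d2) (R : realType)
    (mu : {sigma_finite_measure set T2 -> \bar R}) (g : T1 * T2 -> R) :
  measurable_fun setT g ->
  measurable_fun setT (fun x => \int[mu]_z g (x, z)).
Proof.
move=> mg; have mEg : measurable_fun setT (EFin \o g) by exact/measurable_EFinP.
apply: (measurableT_comp (f := @fine R)) => //.
rewrite (_ : (fun x => _) =
  fubini_F mu (EFin \o g)^\+%E \- fubini_F mu (EFin \o g)^\-%E)%E; last first.
  apply/funext => x; rewrite integralE.
  by congr (_ - _)%E; apply: eq_integral => z _; rewrite ?funeposE ?funenegE.
apply: emeasurable_funB; apply: measurable_fun_fubini_tonelli_F => //.
  exact: measurable_funepos.
exact: measurable_funeneg.
Qed.

(** * Averages of the gradient over small balls *)

Section average.
Context {R : realType} {n : nat}.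
Variable f : 'rV[R]_n -> R.
Hypothesis f_convex : convex_function [set: 'rV[R]_n] f.

Lemma measurable_ball_average_gradient (e : R) : 0 < e ->
  measurable_fun [set: 'rV[R]_n] (ball_average_gradient f e).
Proof.
move=> e0; apply: measurable_fun_rVP => i.
rewrite /ball_average_gradient; under eq_fun do rewrite !mxE.
apply: measurable_funM.
  (* Inversion is continuous away from 0; the measures of the balls all lie in the open half-line of
     positive reals. *)
  apply: (@measurable_comp _ _ _ _ _ _ [set t : R | 0 < t]).
  - by have := measurable_itv `]0 : R, +oo[; rewrite set_itv_o_infty.
  - move=> _ [x _ <-]; have [m m0 ->] := lebesgue_euclid_ball x e0; exact: m0.
  - apply: open_continuous_measurable_fun; first exact: open_gt.
    by move=> t; rewrite inE => t0; apply: inv_continuous; rewrite gt_eqF.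
  - apply: measurableT_comp => //.
    under eq_fun do rewrite -xsection_euclid_band.
    exact: (measurable_fun_xsection _ (measurable_euclid_band e)).
have mE := measurable_differentiability_set f_convex.
(* Extending the gradient by 0 outside [S] turns the integral over a domain moving with x into one
   over the whole space. *)
pose S := euclid_band e `&` snd @^-1` differentiability_set f
  : set ('rV[R]_n * 'rV[R]_n).
have mS2 : measurable (snd @^-1` differentiability_set f
    : set ('rV[R]_n * 'rV[R]_n)).
  by rewrite -[X in measurable X]setTI; apply: measurable_snd.
have mS : measurable S.
  by apply: measurableI => //; exact: measurable_euclid_band.
pose G := (fun p : 'rV[R]_n * 'rV[R]_n => gradient f p.2 ord0 i) \_ S.
rewrite (_ : (fun x => _) = fun x => \int[lebesgue_rV n]_z G (x, z)).
  apply: measurable_Rintegral_param; apply: (iffLR (measurable_restrictT _ mS)).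
  rewrite -[X in measurable_fun _ X]/((fun z => gradient f z ord0 i) \o snd).
  apply: (measurable_comp (F := differentiability_set f)) => //.
  - by move=> _ [p [_ Ep] <-].
  - exact: measurable_gradient.
  - by apply: measurable_funTS; exact: measurable_snd.
apply/funext => x; rewrite Rintegral_mkcond; apply: eq_Rintegral => z _.
by rewrite /G !patchE; congr (if _ then _ else _).
Qed.

(** The subgradient inequality along e_i and -e_i bounds the partial derivatives by increments of f
    that are continuous in z. This makes the gradient integrable on small balls. *)
Lemma gradient_locally_bounded (x : 'rV[R]_n) : exists M : R,
  \forall z \near x, differentiable f z ->
    forall i, `|gradient f z ord0 i| <= M.
Proof.
pose Q (v z : 'rV[R]_n) := f (z + v) - f z.
have cQ v : continuous (Q v).
  move=> z; apply: continuousB; last exact: convex_continuous.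
  exact: convex_continuous_addr.
pose e i : 'rV[R]_n := delta_mx ord0 i.
(* The summand 1 makes the bounds at x strict, so that they persist near x. *)
pose M := 1 + \sum_i (`|Q (e i) x| + `|Q (- e i) x|).
have QM i v : v = e i \/ v = - e i -> Q v x < M.
  move=> ve; apply: (@le_lt_trans _ _ (`|Q (e i) x| + `|Q (- e i) x|)).
    case: ve => ->; rewrite (le_trans (ler_norm _))// ?lerDl// ?lerDr//.
  rewrite /M (bigD1 i)//= addrA ltr_wpDr//; last by rewrite ltrDr.
  by apply: sumr_ge0 => j _; rewrite addr_ge0.
exists M; pose P i z := Q (e i) z <= M /\ Q (- e i) z <= M.
have : \forall z \near x, forall i, P i z.
  refine (@filter_forall _ _ P _ (nbhs_filter _) _) => i; apply: filterI.
    by apply: (cvgr_le _ (cQ (e i) x)); apply: (QM i); left.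
  by apply: (cvgr_le _ (cQ (- e i) x)); apply: (QM i); right.
apply: filterS => z Pz dz i; have [Qe QNe] := Pz i.
rewrite -dotprod_delta ler_norml lerNl -linearN/=; apply/andP; split.
  exact: le_trans (gradient_subgradient f_convex _ dz) QNe.
exact: le_trans (gradient_subgradient f_convex _ dz) Qe.
Qed.

(** By continuity f(z + u) - f(z) stays below c on a small ball around x, and the average of <grad
    f(z), u> inherits this bound. *)
Lemma near_dotprod_average_le (x u : 'rV[R]_n) (c : R) :
  f (x + u) - f x < c ->
  \forall e \near 0^'+, dotprod (ball_average_gradient f e x) u <= c.
Proof.
move=> fc; have [M gM] := gradient_locally_bounded x.
have cQ : continuous (fun z : 'rV[R]_n => f (z + u) - f z).
  move=> z; apply: continuousB; last exact: convex_continuous.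
  exact: convex_continuous_addr.
have near_c : \forall z \near x, f (z + u) - f z <= c.
  by apply: (cvgr_le _ (cQ x)).
pose P z := f (z + u) - f z <= c /\
  (differentiable f z -> forall i, `|gradient f z ord0 i| <= M).
have : \forall z \near x, P z by apply: filterI.
move=> /nbhs_normP[r /= r0 rP].
near=> e.
have e0 : 0 < e by near: e; exact: nbhs_right_gt.
have er : e <= r by near: e; exact: nbhs_right_le.
have {}rP z : euclid_ball x e z -> P z.
  move=> Bz; apply: rP; rewrite /= distrC.
  by rewrite (le_lt_trans (normr_le_euclid _))// (lt_le_trans Bz).
have [m m0 mB] := lebesgue_euclid_ball x e0.
have mball := measurable_euclid_ball x e.
set D := euclid_ball x e `&` differentiability_set f.
have mE := measurable_differentiability_set f_convex.
have mD : measurable D by exact: measurableI.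
(* Almost everywhere differentiability enters here: the domain of integration has the full measure
   of the ball. *)
have Dm : lebesgue_rV n D = m%:E.
  by rewrite lebesgue_rV_setI_differentiability.
have Dfin : (lebesgue_rV n D < +oo)%E by rewrite Dm ltry.
have ig i :
    (lebesgue_rV n).-integrable D (EFin \o (fun z => gradient f z ord0 i)).
  apply: measurable_bounded_integrable => //.
    by apply: measurable_funS (measurable_gradient f_convex i) => // z [].
  exists M; split; first exact: num_real.
  move=> K MK z [Bz dz]; apply: le_trans (ltW MK).
  exact: (rP z Bz).2.
have igu i : (lebesgue_rV n).-integrable D
    (EFin \o (fun z => u ord0 i * gradient f z ord0 i)).
  exact: (integrableZl mD (u ord0 i) (ig i)).
rewrite dotprodC /ball_average_gradient linearZ/= mB/= ler_pdivrMl//.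
rewrite [dotprod _ _](_ : _ =
    \int[lebesgue_rV n]_(z in D) dotprod u (gradient f z)); last first.
  rewrite Rintegral_sum//; apply: eq_bigr => i _.
  by rewrite mxE RintegralZl.
have -> : m * c = \int[lebesgue_rV n]_(z in D) c.
  rewrite Rintegral_cst// [RHS]mulrC; congr (_ * _).
  exact: (esym (congr1 fine Dm)).
apply: le_Rintegral => //.
- rewrite (_ : _ \o _ =
    fun z => (\sum_i (u ord0 i * gradient f z ord0 i)%:E)%E); last first.
    by apply/funext => z /=; rewrite sumEFin.
  by apply: integrable_sum => // i _; exact: igu.
- apply: measurable_bounded_integrable => //.
  by exists `|c|; split => // K cK z _; exact: ltW.
move=> z [Bz dz]; rewrite dotprodC.
exact: le_trans (gradient_subgradient f_convex _ dz) (rP z Bz).1.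
Unshelve. all: by end_near. Qed.

End average.

Unset Implicit Arguments.
Set Strict Implicit.

Theorem proposition4p2 (R : realType) (n : nat) (L : 'rV[R]_n -> R)
    (y : 'rV[R]_n -> 'rV[R]_n) :
  convex_function [set: 'rV[R]_n] L ->
  (forall x : 'rV[R]_n, ball_average_gradient L e x @[e --> 0^'+] --> y x) ->
  measurable_fun [set: 'rV[R]_n] y /\
  (forall x : 'rV[R]_n, subdifferential L x (y x)).
Proof.
move=> L_convex avg_y; split.
  apply: measurable_fun_rVP => i.
  (* Radii 1/(k + 1) give a sequence of Borel maps with pointwise limit y. *)
  pose h (k : nat) x := ball_average_gradient L k.+1%:R^-1 x ord0 i.
  apply: (measurable_fun_cvg (h := h)) => [k|x _].
    apply: (measurableT_comp (measurable_coord i)).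
    by apply: measurable_ball_average_gradient => //; rewrite invr_gt0.
  have avg_yi : ball_average_gradient L e x ord0 i @[e --> 0^'+] --> y x ord0 i.
    exact: (cvg_comp _ _ (avg_y x) (@coord_continuous _ _ _ ord0 i (y x))).
  move/cvg_at_rightP : avg_yi => /(_ (fun k => k.+1%:R^-1)); apply.
  by split; [move=> k; rewrite invr_gt0|exact: cvg_harmonic].
(* The slack d > 0 provides the strict inequality of [near_dotprod_average_le], applied with u = z -
   x. *)
move=> x z; rewrite -lerBrDl; apply/ler_addgt0Pl => d d0.
have avg_yx : dotprod (z - x) (ball_average_gradient L e x) @[e --> 0^'+] -->
    dotprod (z - x) (y x).
  exact: (cvg_comp _ _ (avg_y x) (@continuous_dotprod _ _ (z - x) (y x))).
rewrite dotprodC; apply: (cvgr_to_le avg_yx).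
under eq_near do rewrite dotprodC.
by apply: near_dotprod_average_le => //; rewrite subrKC ltrDr.
Qed.
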